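(* Let $a,b,c,d\in\mathbb{N}$ be such that $ab=cd$, and assume $a=\min(a,b,c,d)$. If $a$ divides either $c$ or $d$, then $$\begin{bmatrix}c+d\\ c\end{bmatrix}-\begin{bmatrix}a+b\\ a\end{bmatrix}\in\mathbb{N}_0[q].$$
   Context: $\mathbb{N}$ is the set of positive integers, $\mathbb{N}_0=\mathbb{N}\cup\{0\}$. $\begin{bmatrix}n\\k\end{bmatrix}=\frac{[n][n-1]\cdots[n-k+1]}{[k][k-1]\cdots[1]}$ is the Gaussian ($q$-)binomial coefficient, a polynomial in $q$, where $[n]=1+q+\cdots+q^{n-1}$. *)

(* Defs.v *)
From mathcomp Require Import all_boot all_order all_algebra.

Set Implicit Arguments.
Unset Strict Implicit.
Unset Printing Implicit Defensive.

Import GRing.Theory.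
Local Open Scope ring_scope.

Definition qint (n : nat) : {poly int} := \sum_(i < n) 'X^i.

(* [n][n-1]...[n-k+1]; for k > n the factor [0] = 0 occurs. *)
Definition qffact (n k : nat) : {poly int} := \prod_(i < k) qint (n - i).

(* Over int, %/ is in general a pseudo-division; here the divisor
   [k][k-1]...[1] is monic, and the division is exact (see qbinomK). *)
Definition qbinom (n k : nat) : {poly int} := qffact n k %/ qffact k k.

Lemma qint_addn m n : qint (m + n) = qint m + 'X^m * qint n.
Proof.
rewrite /qint big_split_ord /= mulr_sumr; congr (_ + _).
by apply: eq_bigr => i _; rewrite exprD.
Qed.

Lemma qint_monic n : qint n.+1 \is monic.
Proof.
have -> : qint n.+1 = \poly_(i < n.+1) 1.
  by rewrite poly_def; apply: eq_bigr => i _; rewrite scale1r.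
by rewrite monicE lead_coef_poly.
Qed.

Lemma qffactnn_monic k : qffact k k \is monic.
Proof.
apply: monic_prod => i _.
by have /prednK <- : (0 < k - i)%N; rewrite ?subn_gt0 // qint_monic.
Qed.

Lemma qffactSS n k : qffact n.+1 k.+1 = qint n.+1 * qffact n k.
Proof. by rewrite /qffact big_ord_recl subn0. Qed.

Lemma qffactnS n k : qffact n k.+1 = qffact n k * qint (n - k).
Proof. by rewrite /qffact big_ord_recr. Qed.

Lemma qffact_small n k : (n < k)%N -> qffact n k = 0.
Proof.
move=> ltnk; rewrite /qffact (bigD1 (Ordinal ltnk)) //= subnn.
by rewrite /qint big_ord0 mul0r.
Qed.

Lemma qffact_dvd n k : exists p : {poly int}, qffact n k = p * qffact k k.
Proof.
elim: n k => [|n IHn] [|k].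
- by exists 1; rewrite mul1r.
- by exists 0; rewrite qffact_small // mul0r.
- by exists 1; rewrite /qffact !big_ord0 mul1r.
have [[p Ep] [r Er]] := (IHn k, IHn k.+1).
exists (p + 'X^(k.+1) * r).
rewrite mulrDl -(mulrA _ r) -Er !qffactSS qffactnS [p * _]mulrCA -Ep.
have [lekn|ltnk] := leqP k n; last by rewrite qffact_small // !(mulr0, mul0r, addr0).
have -> : n.+1 = (k.+1 + (n - k))%N by rewrite addSn subnKC.
rewrite qint_addn mulrDl.
by rewrite [qffact n k * qint (n - k)]mulrC mulrA.
Qed.

Lemma qbinomK n k : qbinom n k * qffact k k = qffact n k.
Proof.
have [p Ep] := qffact_dvd n k.
by rewrite /qbinom Ep (Pdiv.IdomainMonic.mulpK (qffactnn_monic k)).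
Qed.

(* Main.v *)
Require Import Defs.
From mathcomp Require Import all_boot all_order all_algebra.
From mathcomp Require Import zify ring.

(** After the symmetry exchanging c and d, write c = a m and b = m d with
a <= d. The claim becomes
    [am+d choose d] - [a+md choose a] has coefficients in N.

The polynomial [am+d choose d] is the coefficient of T^d in the product of the
1/(1 - q^k T) for 0 <= k <= am. Sort the exponents k by their residue modulo
m, and put Q = q^m. The multiples of m are m t with 0 <= t <= a; they form the
series whose coefficients are the binomials [a+n choose n] in base Q. Each
nonzero residue r gives r + m t with 0 <= t < a. Let A_s(a) be the coefficient
of T^s in the product over all nonmultiples of m. Then
    [am+d choose d] = sum_s A_s(a) [a+d-s choose d-s]_Q,
    [a+md choose a] = sum_s A_s(d) [a+d-s choose a-s]_Q,
the second line being the first with a and d exchanged (qbinom_residues).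

As a function of its argument, A_s is a combination of the binomials
[x choose i]_Q with i <= s, whose coefficients lie in N[q] and do not depend
on x (nat_comb_nonmultiple). This reduces the comparison of the terms of index
s <= a to a comparison of binomials: with n = a+d-s,
    [d choose i] [n choose a-s] = [n choose i] [n-i choose a-s],
    [a choose i] [n choose d-s] = [n choose i] [n-i choose a-i],
and since a-s <= a-i and (a-s) + (a-i) <= n-i (this is where a <= d enters),
the second is at least the first by the coefficientwise unimodality of the
Gaussian binomials (qbinom_unimodal). The terms with a < s <= d occur in the
first sum only. *)

Set Implicit Arguments.
Unset Strict Implicit.
Unset Printing Implicit Defensive.

Import Order.TTheory GRing.Theory Num.Theory.
Local Open Scope ring_scope.

(* [Num.nat] is a qualifier; the closure properties of [polyOver] are attached
to the predicate underlying it. *)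
Local Notation natpoly := (polyOver (Num.nat_num_subdef : {pred int})).

(** * Gaussian binomials: symmetry, Pascal rules, products *)

Lemma natpolyX n : 'X^n \is a natpoly.
Proof. exact: polyOverXn. Qed.

Lemma qffactnn_neq0 k : qffact k k != 0.
Proof. exact: monic_neq0 (qffactnn_monic k). Qed.

Lemma qbinom0 n : qbinom n 0 = 1.
Proof.
apply: (mulIf (qffactnn_neq0 0)).
by rewrite qbinomK mul1r /qffact !big_ord0.
Qed.

Lemma qbinom_small n k : (n < k)%N -> qbinom n k = 0.
Proof.
move=> ltnk; apply: (mulIf (qffactnn_neq0 k)).
by rewrite qbinomK mul0r qffact_small.
Qed.

Lemma qffact_cat n k j : qffact n (k + j) = qffact n k * qffact (n - k) j.
Proof.
by rewrite /qffact big_split_ord; congr (_ * _); apply: eq_bigr => i _; rewrite subnDA.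
Qed.

Lemma qbinom_fact n k : (k <= n)%N ->
  qbinom n k * (qffact k k * qffact (n - k) (n - k)) = qffact n n.
Proof. by move=> lekn; rewrite mulrA qbinomK -qffact_cat subnKC. Qed.

Lemma qbinom_sub n k : (k <= n)%N -> qbinom n (n - k) = qbinom n k.
Proof.
move=> lekn; apply: (mulIf (mulf_neq0 (qffactnn_neq0 k) (qffactnn_neq0 (n - k)))).
have Ek := qbinom_fact (leq_subr k n); rewrite subKn // in Ek.
by rewrite (qbinom_fact lekn) [qffact k k * _]mulrC Ek.
Qed.

Lemma qbinomnn n : qbinom n n = 1.
Proof. by rewrite -[RHS](qbinom0 n) -(qbinom_sub (leq0n n)) subn0. Qed.

Lemma qbinomS n k :
  qbinom n.+1 k.+1 = qbinom n k + 'X^(k.+1) * qbinom n k.+1.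
Proof.
have [lekn|ltnk] := leqP k n; last first.
  by rewrite !qbinom_small ?mulr0 ?addr0 ?ltnS //; apply: ltnW.
apply: (mulIf (qffactnn_neq0 k.+1)).
rewrite mulrDl -(mulrA 'X^_) !qbinomK !qffactSS mulrCA qbinomK qffactnS.
by rewrite -{1}(subnKC lekn) -addSn qint_addn; ring.
Qed.

Lemma qbinomSr n k : (k <= n)%N ->
  qbinom n.+1 k.+1 = 'X^(n - k) * qbinom n k + qbinom n k.+1.
Proof.
rewrite leq_eqVlt => /predU1P[->|ltkn].
  by rewrite !qbinomnn subnn mul1r qbinom_small ?addr0.
rewrite -qbinom_sub ?ltnS ?(ltnW ltkn) // subSS.
have -> : (n - k = (n - k.+1).+1)%N by lia.
rewrite qbinomS qbinom_sub //.
have -> : (n - k.+1).+1 = (n - k)%N by lia.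
by rewrite qbinom_sub ?(ltnW ltkn) // addrC.
Qed.

Lemma qbinom_nat n k : qbinom n k \is a natpoly.
Proof.
elim: n k => [|n IHn] [|k]; rewrite ?qbinom0 ?rpred1 //.
  by rewrite qbinom_small // rpred0.
by rewrite qbinomS rpredD ?rpredM ?natpolyX.
Qed.

(** Choosing an i-set and then a k-set outside it amounts to choosing their
union and then the i-set inside it; all factorials involved are nonzero, so the
identity can be checked after multiplying by them. *)
Lemma qbinom_mul n i k : (i <= n)%N ->
  qbinom n i * qbinom (n - i) k = qbinom n (i + k) * qbinom (i + k) i.
Proof.
move=> le_i_n; have [le_ik_n|lt_n_ik] := leqP (i + k) n; last first.
  by rewrite (@qbinom_small (n - i)) ?(@qbinom_small n (i + k)) ?mulr0 ?mul0r //; lia.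
have nz : qffact i i * qffact k k * qffact (n - i - k) (n - i - k) != 0.
  by rewrite !mulf_neq0 ?qffactnn_neq0.
apply: (mulIf nz).
have le_k_ni : (k <= n - i)%N by lia.
have E1 := qbinom_fact le_i_n.
have E2 := qbinom_fact le_k_ni.
have E3 := qbinom_fact le_ik_n.
have E4 := qbinom_fact (leq_addr k i).
rewrite addKn in E4; rewrite subnDA in E3.
transitivity (qffact n n).
  by rewrite -E1 -E2; ring.
by rewrite -E3 -E4; ring.
Qed.

(** * Coefficientwise unimodality *)

(** The case e = 0 is what unimodality needs, but the Pascal rules express the
difference for N + 1 through differences for N in which the second term carries
a power of 'X. The bound on e is the one that makes the degree of the second
term at most that of the first. *)
Lemma qbinom_succ_shift N k e : (e + k.*2 < N)%N ->
  qbinom N k.+1 - 'X^e * qbinom N k \is a natpoly.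
Proof.
elim: N k e => [//|N IHN] k e; rewrite ltnS => le_ek_N.
case: e le_ek_N => [|e] le_ek_N.
  (* In the middle, e = 0 and 2k + 1 = N + 1, both binomials agree. *)
  rewrite mul1r; move: le_ek_N; rewrite add0n leq_eqVlt => /predU1P[defN|lt_k_N].
    rewrite -qbinom_sub; last by lia.
    have -> : (N.+1 - k.+1 = k)%N by lia.
    by rewrite subrr rpred0.
  case: k lt_k_N => [|k] lt_k_N.
    rewrite qbinomSr // !qbinom0 mulr1 subn0 -addrA.
    have := IHN 0 0 lt_k_N; rewrite qbinom0 expr0 mulr1 => pos1.
    by rewrite rpredD ?natpolyX.
  (* The rule qbinomS would lower e, hence the other Pascal rule. *)
  rewrite !qbinomSr; [|lia..].
  set A := qbinom N k.+2; set B := qbinom N k.+1; set C := qbinom N k.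
  have -> : 'X^(N - k.+1) * B + A - ('X^(N - k) * C + B) =
     (A - 'X^0 * B) + 'X^(N - k.+1) * (B - 'X^1 * C).
    have -> : (N - k = (N - k.+1).+1)%N by lia.
    rewrite !exprS.
    ring.
  by rewrite rpredD ?rpredM ?natpolyX ?IHN //; lia.
case: k le_ek_N => [|k] le_ek_N.
  rewrite qbinomS !qbinom0 mulr1.
  have -> : 1 + 'X^1 * qbinom N 1 - 'X^(e.+1) = 1 + 'X^1 * (qbinom N 1 - 'X^e * qbinom N 0).
    by rewrite qbinom0 !exprS; ring.
  by rewrite rpredD ?rpredM ?rpred1 ?natpolyX ?IHN //; lia.
rewrite !qbinomS.
set A := qbinom N k.+2; set B := qbinom N k.+1; set C := qbinom N k.
have -> : B + 'X^(k.+2) * A - 'X^(e.+1) * (C + 'X^(k.+1) * B) =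
   (B - 'X^(e.+1) * C) + 'X^(k.+2) * (A - 'X^e * B).
  by rewrite !exprS; ring.
by apply: rpredD; [apply: IHN | apply: rpredM; [exact: natpolyX | apply: IHN]]; lia.
Qed.

(** The hypothesis k + l <= N places l between k and its mirror image N - k; an l
beyond the middle is reflected to N - l. *)
Lemma qbinom_unimodal N k l : (k <= l)%N -> (k + l <= N)%N ->
  qbinom N l - qbinom N k \is a natpoly.
Proof.
move=> lekl; have below l' : (k <= l')%N -> (l'.*2 <= N)%N ->
    qbinom N l' - qbinom N k \is a natpoly.
  elim: l' => [|l' IH]; first by rewrite leqn0 => /eqP->; rewrite subrr rpred0.
  rewrite leq_eqVlt => /predU1P[<- _|lekl' le_l'_N]; first by rewrite subrr rpred0.
  rewrite -(subrK (qbinom N l') (qbinom N l'.+1)) -addrA rpredD ?IH //; last by lia.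
  by rewrite -[X in _ - X]mul1r -(expr0 'X); apply: qbinom_succ_shift; lia.
move=> leklN; have [|gtN] := leqP l.*2 N; first exact: below.
by rewrite -(@qbinom_sub N l) ?below //; lia.
Qed.

(** Both products split off [n choose i], where n = a + d - s, leaving two
binomials over n - i that unimodality compares. *)
Lemma qbinom_trade a d s i : (i <= s <= a)%N -> (a <= d)%N ->
  qbinom a i * qbinom (a + d - s) (d - s)
    - qbinom d i * qbinom (a + d - s) (a - s) \is a natpoly.
Proof.
case/andP=> leis lesa lead; set n := (a + d - s)%N.
have trade u v : (i <= u <= n)%N -> (u + v = n)%N ->
    qbinom u i * qbinom n v = qbinom n i * qbinom (n - i) (u - i).
  move=> /andP[le_i_u le_u_n] uv.
  rewrite (@qbinom_mul n i (u - i)) ?(leq_trans le_i_u) // subnKC // mulrC.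
  congr (_ * _).
  by rewrite -(@qbinom_sub n u) //; congr qbinom; lia.
rewrite (trade a) ?(trade d) /n; [|lia..].
rewrite -mulrBr rpredM ?qbinom_nat // -/n.
rewrite -(@qbinom_sub (n - i) (d - i)); last by rewrite /n; lia.
by apply: qbinom_unimodal; rewrite /n; lia.
Qed.

(** * Combinations of binomials with coefficients in N[q] *)

(** The Gaussian binomial in base 'X^m. *)
Definition qbinomX m n k := qbinom n k \Po 'X^m.

Lemma natpoly_comp m p : p \is a natpoly -> p \Po 'X^m \is a natpoly.
Proof. by move=> pos_p; rewrite polyOver_comp ?natpolyX. Qed.

Lemma qbinomX_small m n k : (n < k)%N -> qbinomX m n k = 0.
Proof. by move=> ltnk; rewrite /qbinomX qbinom_small ?comp_poly0. Qed.

Lemma qbinomX0 m n : qbinomX m n 0 = 1.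
Proof. by rewrite /qbinomX qbinom0 rmorph1. Qed.

(** [f] is a combination of Gaussian binomials of index at most [s] whose
coefficients have natural coefficients and, above all, do not depend on the
upper entry [d]: the same [c] then serves for [f a] and [f d]. *)
Definition nat_comb m s (f : nat -> {poly int}) :=
  exists2 c : nat -> {poly int}, forall i, c i \is a natpoly
    & forall d, f d = \sum_(i < s.+1) c i * qbinomX m d i.

Section NatComb.
Variable m : nat.
Implicit Types f g : nat -> {poly int}.

Lemma nat_comb_ext s f g : f =1 g -> nat_comb m s f -> nat_comb m s g.
Proof. by move=> eqfg [c c_pos Ef]; exists c => // d; rewrite -eqfg Ef. Qed.

Lemma nat_comb_basis s i : (i <= s)%N -> nat_comb m s (fun d => qbinomX m d i).
Proof.
rewrite -ltnS => lt_i_s; exists (fun j => (j == i)%:R) => [j|d].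
  exact: rpred_nat.
rewrite (bigD1 (Ordinal lt_i_s)) //= eqxx mul1r big1 ?addr0 // => j ne_ji.
by rewrite -val_eqE /= in ne_ji; rewrite (negPf ne_ji) mul0r.
Qed.

Lemma nat_comb0 s : nat_comb m s (fun=> 0).
Proof.
exists (fun=> 0) => [i|d]; first exact: rpred0.
by rewrite big1 // => i _; rewrite mul0r.
Qed.

Lemma nat_comb_add s f g :
  nat_comb m s f -> nat_comb m s g -> nat_comb m s (fun d => f d + g d).
Proof.
move=> [c c_pos Ef] [e e_pos Eg]; exists (fun i => c i + e i) => [i|d].
  exact: rpredD.
by rewrite Ef Eg -big_split; apply: eq_bigr => i _; rewrite mulrDl.
Qed.

Lemma nat_comb_scale s p f :
  p \is a natpoly -> nat_comb m s f -> nat_comb m s (fun d => p * f d).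
Proof.
move=> pos_p [c c_pos Ef]; exists (fun i => p * c i) => [i|d].
  exact: rpredM.
by rewrite Ef mulr_sumr; apply: eq_bigr => i _; rewrite mulrA.
Qed.

Lemma nat_comb_sum s k (F : nat -> nat -> {poly int}) :
  (forall i, (i < k)%N -> nat_comb m s (F i)) ->
  nat_comb m s (fun d => \sum_(i < k) F i d).
Proof.
elim: k => [|k IHk] pos_F.
  by apply: nat_comb_ext (nat_comb0 s) => d; rewrite big_ord0.
have pos_k : nat_comb m s (fun d => \sum_(i < k) F i d).
  by apply: IHk => i lt_i_k; apply: pos_F; apply: ltnW.
apply: nat_comb_ext (nat_comb_add pos_k (pos_F k (ltnSn k))) => d.
by rewrite big_ord_recr.
Qed.

Lemma nat_comb_weaken s t f : (s <= t)%N -> nat_comb m s f -> nat_comb m t f.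
Proof.
move=> le_s_t [c c_pos Ef].
have sumP := @nat_comb_sum t s.+1 (fun i d => c i * qbinomX m d i).
apply: nat_comb_ext (sumP _) => [d|i le_i_s]; first by rewrite Ef.
by apply: nat_comb_scale => //; apply: nat_comb_basis; apply: leq_trans le_s_t.
Qed.

(** An existential form of the q-Vandermonde identity: Pascal's rule lowers [N]
without ever introducing a negative coefficient. *)
Lemma nat_comb_shift N j : nat_comb m j (fun d => qbinomX m (d + N) j).
Proof.
elim: N j => [|N IHN] [|j].
- by apply: nat_comb_ext (nat_comb_basis (leqnn 0)) => d; rewrite addn0.
- by apply: nat_comb_ext (nat_comb_basis (leqnn j.+1)) => d; rewrite addn0.
- by apply: nat_comb_ext (nat_comb_basis (leqnn 0)) => d; rewrite !qbinomX0.
have pos_j := nat_comb_weaken (leqnSn j) (IHN j).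
have pos_jS := nat_comb_scale (natpoly_comp m (natpolyX j.+1)) (IHN j.+1).
apply: nat_comb_ext (nat_comb_add pos_j pos_jS) => d.
by rewrite /qbinomX addnS qbinomS rmorphD rmorphM.
Qed.

(** For i <= d, expand [(d + j).-1 choose j] over d - i by [nat_comb_shift] and
recombine [d choose i] [d - i choose k] into multiples of [d choose i + k]. *)
Lemma nat_comb_mul_basis i j :
  nat_comb m (i + j) (fun d => qbinomX m d i * qbinomX m (d + j).-1 j).
Proof.
case: j => [|j].
  by apply: nat_comb_ext (nat_comb_basis (leq_addr 0 i)) => d; rewrite qbinomX0 mulr1.
have [c c_pos Ec] := nat_comb_shift (i + j) j.+1.
have sumP := @nat_comb_sum (i + j.+1) j.+2
   (fun k d => (c k * qbinomX m (i + k) i) * qbinomX m d (i + k)).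
apply: nat_comb_ext (sumP _) => [d|k le_k_j]; last first.
  apply: nat_comb_scale; last by apply: nat_comb_basis; rewrite leq_add2l -ltnS.
  by rewrite rpredM ?natpoly_comp ?qbinom_nat.
rewrite addnS /=; have [le_i_d|lt_d_i] := leqP i d; last first.
  (* Here d - i truncates, but every binomial in sight vanishes. *)
  rewrite qbinomX_small // mul0r big1 // => k _.
  by rewrite [X in _ * X]qbinomX_small ?mulr0 // (leq_trans lt_d_i) ?leq_addr.
have -> : (d + j = (d - i) + (i + j))%N by lia.
rewrite Ec mulr_sumr; apply: eq_bigr => k _.
rewrite mulrCA -mulrA [qbinomX m (i + k) i * _]mulrC; congr (_ * _).
by rewrite /qbinomX -!comp_polyM qbinom_mul.
Qed.

Lemma nat_comb_mul i j f :
  nat_comb m i f -> nat_comb m (i + j) (fun d => f d * qbinomX m (d + j).-1 j).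
Proof.
move=> [c c_pos Ef].
have sumP := @nat_comb_sum (i + j) i.+1
   (fun k d => c k * (qbinomX m d k * qbinomX m (d + j).-1 j)).
apply: nat_comb_ext (sumP _) => [d|k le_k_i]; last first.
  apply: nat_comb_scale => //.
  by apply: nat_comb_weaken (nat_comb_mul_basis k j); rewrite leq_add2r -ltnS.
by rewrite Ef mulr_suml; apply: eq_bigr => k _; rewrite mulrA.
Qed.

End NatComb.

(** * Splitting the generating series by residues *)

(** The series 1/(1 - 'X^k T) truncated at T^N, the outer variable being T. Only
coefficients of index below N are ever read, where the truncation is
invisible. *)
Definition geo N k : {poly {poly int}} := \poly_(j < N) 'X^(k * j).

Lemma coef_mul_geo N p k n : (n.+1 < N)%N ->
  (p * geo N k)`_n.+1 = p`_n.+1 + 'X^k * (p * geo N k)`_n.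
Proof.
move=> lt_n_N; rewrite !coefM big_ord_recr /= subnn coef_poly (ltn_trans _ lt_n_N) //.
rewrite muln0 mulr1 addrC mulr_sumr; congr (_ + _); apply: eq_bigr => j _.
rewrite subSn -1?ltnS // !coef_poly.
have -> : ((n - j).+1 < N)%N by lia.
have -> : ((n - j) < N)%N by lia.
by rewrite mulnS exprD mulrCA.
Qed.

Lemma coef0_geo N k : (0 < N)%N -> (geo N k)`_0 = 1.
Proof. by move=> N_gt0; rewrite coef_poly N_gt0 muln0. Qed.

Definition progression_series N c m a := \prod_(t < a) geo N (c + m * t).

(** Multisets of size n of exponents c + m t with t < a: the q-binomial theorem
in base 'X^m. The predecessor is harmless for a = n = 0, where both sides are
1. *)
Lemma coef_progression N c m a n : (n < N)%N ->
  (progression_series N c m a)`_n = 'X^(c * n) * qbinomX m (a + n).-1 n.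
Proof.
rewrite /progression_series; elim: a n => [|a IHa] n lt_n_N.
  rewrite big_ord0 coef1; case: n lt_n_N => [|n] _; first by rewrite muln0 qbinomX0 mulr1.
  by rewrite qbinomX_small ?mulr0.
rewrite big_ord_recr /=; elim: n lt_n_N => [|n IHn] lt_n_N.
  by rewrite coef0M IHa // coef0_geo // !qbinomX0 mulr1.
rewrite coef_mul_geo // IHa // IHn 1?ltnW //.
rewrite !addnS /= /qbinomX qbinomSr ?leq_addl // addnK comp_polyD comp_polyM comp_Xn_poly.
by rewrite -exprM mulnS !exprD; ring.
Qed.

Lemma prod_residues (R : comPzSemiRingType) (g : nat -> R) a m :
  \prod_(k < a * m) g k = \prod_(r < m) \prod_(t < a) g (r + m * t)%N.
Proof.
rewrite exchange_big /=; elim: a => [|a IHa]; first by rewrite !big_ord0.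
rewrite big_ord_recr -IHa mulSnr big_split_ord /=; congr (_ * _).
by apply: eq_bigr => r _; rewrite addnC mulnC.
Qed.

(** For M.+1 = m, the exponents are the nonmultiples of m in [0, a m]. *)
Definition nonmultiple_series N m M a :=
  \prod_(r < M) progression_series N r.+1 m a.

(** Each residue contributes a factor whose coefficients are, up to a power of
'X, rising binomials [(a + n).-1 choose n]; multiplying by these preserves
[nat_comb]. *)
Lemma nat_comb_nonmultiple N m M s : (s < N)%N ->
  nat_comb m s (fun a => (nonmultiple_series N m M a)`_s).
Proof.
elim: M s => [|M IHM] s lt_s_N.
  apply: nat_comb_ext (nat_comb_scale (rpred_nat _ (s == 0%N)) (nat_comb_basis m (leq0n s))) => d.
  by rewrite /nonmultiple_series big_ord0 coef1 qbinomX0 mulr1.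
have sumP := @nat_comb_sum m s s.+1 (fun j d => (nonmultiple_series N m M d)`_j *
   (progression_series N M.+1 m d)`_(s - j)).
apply: nat_comb_ext (sumP _) => [d|j lt_j_s].
  by rewrite -coefM /nonmultiple_series big_ord_recr.
have IHj := IHM j ltac:(lia).
have := nat_comb_scale (natpolyX (M.+1 * (s - j))) (nat_comb_mul (s - j) IHj).
rewrite subnKC 1?ltnS //; apply: nat_comb_ext => d.
by rewrite coef_progression 1?mulrCA //; lia.
Qed.

(** The top exponent a * m.+1 is the one multiple of the modulus that is missing
from the a full periods; with it the multiples number a + 1. *)
Lemma qbinom_residues N m a d : (d < N)%N ->
  qbinom (a * m.+1 + d) d =
    \sum_(s < d.+1) (nonmultiple_series N m.+1 m a)`_s * qbinomX m.+1 (a + d - s) (d - s).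
Proof.
move=> lt_d_N; pose g := geo N.
have <- : (\prod_(k < (a * m.+1).+1) g k)`_d = qbinom (a * m.+1 + d) d.
  have := coef_progression 0 1 (a * m.+1).+1 lt_d_N.
  rewrite mul0n mul1r /qbinomX comp_polyXr /progression_series => <-.
  by congr (polyseq _)`_d; apply: eq_bigr => k _; rewrite mul1n.
have -> : \prod_(k < (a * m.+1).+1) g k =
    nonmultiple_series N m.+1 m a * progression_series N 0 m.+1 a.+1.
  rewrite big_ord_recr prod_residues big_ord_recl /= mulrAC mulrC; congr (_ * _).
  by rewrite /progression_series big_ord_recr /= mulnC.
rewrite coefM; apply: eq_bigr => s _; rewrite coef_progression; last by lia.
by rewrite mul0n mul1r addSn addnBA // -ltnS.
Qed.

(** * The comparison *)

(** Both binomials are expanded by [qbinom_residues], with the roles of a and d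
exchanged, and compared term by term in s and then in i. *)
Lemma qbinom_mul_swap_le a d m : (a <= d)%N ->
  qbinom (a * m.+1 + d) d - qbinom (a + m.+1 * d) a \is a natpoly.
Proof.
move=> le_a_d; have [N lt_d_N] : exists N, (d < N)%N by exists d.+1.
have lt_a_N := leq_ltn_trans le_a_d lt_d_N.
rewrite [(a + _)%N]addnC [(m.+1 * d)%N]mulnC.
rewrite (qbinom_residues m a lt_d_N) (qbinom_residues m d lt_a_N).
pose A u s := (nonmultiple_series N m.+1 m u)`_s.
have pos_A s : (s <= d)%N -> nat_comb m.+1 s (A^~ s).
  by move=> le_s_d; apply/nat_comb_nonmultiple/(leq_ltn_trans le_s_d).
have -> : d.+1 = (a.+1 + (d - a))%N by lia.
rewrite big_split_ord /= addrAC -sumrB rpredD ?rpred_sum // => s _.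
  have [c c_pos Ec] : nat_comb m.+1 s (A^~ s) by apply: pos_A; have := ltn_ord s; lia.
  rewrite -/(A a s) -/(A d s) !Ec !mulr_suml -sumrB rpred_sum // => i _.
  rewrite -!mulrA -mulrBr rpredM // [(d + a)%N]addnC /qbinomX -!comp_polyM -comp_polyB.
  apply: natpoly_comp; apply: qbinom_trade => //.
  by have := (ltn_ord i, ltn_ord s); rewrite !ltnS => -[-> ->].
rewrite rpredM ?natpoly_comp ?qbinom_nat //.
have [|c c_pos Ec] := pos_A (a.+1 + s)%N; first by have := ltn_ord s; lia.
rewrite -/(A a _) Ec rpred_sum // => i _.
by rewrite rpredM ?natpoly_comp ?qbinom_nat.
Qed.

Theorem corollary1p5 (a b c d : nat)
    (ha : (0 < a)%N) (hb : (0 < b)%N) (hc : (0 < c)%N) (hd : (0 < d)%N)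
    (habcd : (a * b = c * d)%N)
    (hmin : a = minn (minn a b) (minn c d))
    (hdvd : (a %| c)%N \/ (a %| d)%N) :
  qbinom (c + d) c - qbinom (a + b) a \is a polyOver (Num.nat : {pred int}).
Proof.
wlog dvd_a_c : c d hc hd habcd hmin hdvd / (a %| c)%N => [main|].
  case: (hdvd) => [|dvd_a_d]; first exact: main.
  rewrite -(qbinom_sub (leq_addr d c)) addKn addnC.
  by apply: (main d c) => //; [rewrite [RHS]mulnC | rewrite [minn d c]minnC | left].
have le_a_d : (a <= d)%N by lia.
case/dvdnP: dvd_a_c => -[|m] def_c; first by rewrite def_c in hc.
have -> : b = (m.+1 * d)%N.
  by apply/eqP; rewrite -(eqn_pmul2l ha) habcd def_c; apply/eqP; lia.
rewrite def_c mulnC -(qbinom_sub (leq_addr d _)) addKn.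
exact: qbinom_mul_swap_le.
Qed.
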